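(* Let $m\geq 2$ be an integer and let $\beta>1$ be the root of $x^2-mx-1$. Then $$\mathbb{Z}_\beta\cap\mathbb{R}^+=(\mathbb{Z}_{-\beta}\cup\beta\mathbb{Z}_{-\beta})\cap\mathbb{R}^+ .$$
   Context: Here $\mathbb{R}^+=[0,+\infty)$. **$\beta$-integers.** For $\beta>1$ let $T_\beta(x)=\beta x-\lfloor\beta x\rfloor$ on $[0,1)$, and for $x\in[0,1)$ put $d_\beta(x)=y_1y_2y_3\cdots$ with $y_i=\lfloor\beta T_\beta^{i-1}(x)\rfloor$. For real $x\geq 0$ choose an integer $k\ge 0$ with $x/\beta^k\in[0,1)$; if $d_\beta(x/\beta^k)=y_1y_2\cdots$, then $x$ is said to have an integer $\beta$-expansion if $y_i=0$ for all $i>k$ (this does not depend on the choice of $k$). $\mathbb{Z}_\beta^+$ is the set of all $x\geq 0$ with integer $\beta$-expansion, and $\mathbb{Z}_\beta=\mathbb{Z}_\beta^+\cup(-\mathbb{Z}_\beta^+)$. **$(-\beta)$-integers.** Let $l=-\frac{\beta}{\beta+1}$, $I=[l,l+1)$, $T(x)=-\beta x-\lfloor-\beta x-l\rfloor$ on $I$, and for $x\in I$ put $d_{-\beta}(x)=y_1y_2y_3\cdots$ with $y_i=\lfloor-\beta T^{i-1}(x)-l\rfloor$. For $x\in\mathbb{R}$ choose an integer $k\geq 0$ with $x/(-\beta)^k\in(l,l+1)$; if $d_{-\beta}(x/(-\beta)^k)=y_1y_2\cdots$, then $x\in\mathbb{Z}_{-\beta}$ if and only if $y_i=0$ for all $i>k$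 (this does not depend on the choice of $k$). *)

(* Defs.v *)
From mathcomp Require Import all_boot all_order all_algebra.
From mathcomp Require Import boolp classical_sets reals.

Set Implicit Arguments.
Unset Strict Implicit.
Unset Printing Implicit Defensive.

Import Order.TTheory GRing.Theory Num.Theory.

Local Open Scope classical_set_scope.
Local Open Scope ring_scope.

(* The transformations and digit functions below are total on R; they have
   their intended meaning on [0, 1) (for base b) and on [l, l + 1) (for base
   - b), the only places where the sets of integers use them. Digits are
   numbered from 1; the value at index 0 is not used. *)

Definition beta_map (R : realType) (b x : R) : R :=
  b * x - (Num.floor (b * x))%:~R.

Definition beta_digit (R : realType) (b x : R) (i : nat) : int :=
  Num.floor (b * iter i.-1 (beta_map b) x).

(* The condition on k does not depend on the choice of k, and such a k always
   exists when b > 1, so an existential quantifier expresses "choose k". *)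
Definition beta_integers_nneg (R : realType) (b : R) : set R :=
  [set x | 0 <= x /\
    exists k : nat, 0 <= x / b ^+ k < 1 /\
      forall i : nat, (k < i)%N -> beta_digit b (x / b ^+ k) i = 0].

Definition beta_integers (R : realType) (b : R) : set R :=
  beta_integers_nneg b `|` [set - x | x in beta_integers_nneg b].

Definition negbeta_left (R : realType) (b : R) : R := - (b / (b + 1)).

Definition negbeta_map (R : realType) (b x : R) : R :=
  - b * x - (Num.floor (- b * x - negbeta_left b))%:~R.

Definition negbeta_digit (R : realType) (b x : R) (i : nat) : int :=
  Num.floor (- b * iter i.-1 (negbeta_map b) x - negbeta_left b).

(* The interval is open on the left here, although negbeta_map acts on
   [l, l + 1): otherwise the condition would depend on k. *)
Definition negbeta_integers (R : realType) (b : R) : set R :=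
  [set x | exists k : nat,
    negbeta_left b < x / (- b) ^+ k < negbeta_left b + 1 /\
    forall i : nat, (k < i)%N -> negbeta_digit b (x / (- b) ^+ k) i = 0].

(* Main.v *)
(** For [z = a + c b] in [Z[b]] let [z' = a - c / b] be its conjugate. Both sets
    of integers are cut-and-project sets: for [x >= 0], [x] is a [b]-integer iff
    [x] lies in [Z[b]] with [-1 < x' < b], and [x] is a [(-b)]-integer iff [x]
    lies in [Z[b]] with [0 <= x' < b]. The digits of both expansions are in
    [{0, ..., m}], which bounds the conjugate of the integer part; conversely,
    the remainder [t] after [k] digits lies in [Z[b]] with both [t] and [t']
    bounded, so [t = a + c b] with [|c| <= 1], and the few candidates other than
    [t = 0] are ruled out by their conjugates. Multiplication by [b] multiplies
    conjugates by [-1/b] and so maps the window [[0, b)] onto [(-1, 0]]. *)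

Require Import Defs.
From mathcomp Require Import all_boot all_order all_algebra.
From mathcomp Require Import boolp classical_sets reals.
From mathcomp Require Import ring lra zify.

Set Implicit Arguments.
Unset Strict Implicit.
Unset Printing Implicit Defensive.

Import Order.TTheory GRing.Theory Num.Theory.

Local Open Scope classical_set_scope.
Local Open Scope ring_scope.

(** * Growth of powers and integer rounding *)

Lemma expr_unbounded (R : archiRealDomainType) (b C : R) :
  2 <= b -> exists n : nat, C < b ^+ n.
Proof.
move=> b2; exists (Num.bound C).
by apply: (lt_le_trans (upper_nthrootP (leqnn _))); apply: lerXn2r; rewrite ?nnegrE; lra.
Qed.

(** Once all further digits vanish, the orbit of the remainder is geometric with ratio [b] or [- b],
    yet it stays in the unit ball. *)
Lemma bounded_orbit_eq0 (R : archiRealFieldType) (q t : R) :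
  2 <= `|q| -> (forall n : nat, `|q ^+ n * t| <= 1) -> t = 0.
Proof.
move=> q2 bnd; apply/eqP; apply/negPn/negP => t0.
have tp : 0 < `|t| by rewrite normr_gt0.
have [n Hn] := expr_unbounded (`|t|^-1) q2.
have := bnd n; rewrite normrM normrX leNgt => /negP; apply.
by rewrite -ltr_pdivrMr // div1r.
Qed.

Lemma intr_le_pred (R : numDomainType) (n p : int) :
  n <= p -> n != p -> n%:~R <= p%:~R - 1 :> R.
Proof.
move=> np /negbTE np'; have : n <= p - 1 by lia.
by rewrite -(ler_int R) intrB.
Qed.

(** * Arithmetic and conjugates in [Z[b]] *)

Section QuadraticUnit.
Variables (R : realType) (m : nat) (b : R).
Hypotheses (hm : (2 <= m)%N) (hb1 : 1 < b) (hb : root ('X^2 - m%:R *: 'X - 1) b).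

Local Notation g := (b^-1).

Lemma quadratic_unit_bounds :
  [/\ b = m%:R + g, 0 < g, 2 * g < 1 & 2 <= m%:R :> R].
Proof.
have b0 : 0 < b := lt_trans ltr01 hb1.
have bg : b * g = 1 by rewrite divff // lt0r_neq0.
have bE : b = m%:R + g.
  move: hb; rewrite /root !hornerE => /eqP E.
  by apply: (mulfI (lt0r_neq0 b0)); rewrite mulrDr bg; lra.
have g0 : 0 < g by rewrite invr_gt0.
have m2 : 2 <= m%:R :> R by rewrite (ler_nat R 2).
by split=> //; nra.
Qed.

Lemma b_ge2 : 2 <= b. Proof. by have [] := quadratic_unit_bounds; lra. Qed.

Lemma b_mulV : b * g = 1. Proof. by rewrite divff //; apply: lt0r_neq0; have := b_ge2; lra. Qed.

(* The pair [(a, c)] is in fact unique, as [b] is irrational, but the proof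
   works with a given representation and never needs this. *)
Definition conj_in (P : R -> Prop) (x : R) : Prop :=
  exists a c : int, x = a%:~R + c%:~R * b /\ P (a%:~R - c%:~R * g).

(** The number minus its conjugate is [c * (b + g)], and [b + 2 < 2 * (b + g)] because [b >= 2]. *)
Lemma coef_small (t : R) (a c : int) : t = a%:~R + c%:~R * b ->
  `|t - (a%:~R - c%:~R * g)| < b + 2 -> `|c| <= 1.
Proof.
have [bE g0 g1 m2] := quadratic_unit_bounds; have bg := b_mulV => -> H.
have {}H : `|c%:~R * (b + g)| < 2 * (b + g).
  have -> : c%:~R * (b + g) = a%:~R + c%:~R * b - (a%:~R - c%:~R * g) by ring.
  by apply: (lt_le_trans H); lra.
move: H; rewrite normrM (@ger0_norm _ (b + g)); last lra.
rewrite ltr_pM2r; last lra.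
by rewrite -intr_norm (ltr_int R _ 2); lia.
Qed.

Lemma int_norm_le1_cases (c : int) : `|c| <= 1 -> [\/ c = 0, c = 1 | c = -1].
Proof.
move=> h; have : c = 0 \/ c = 1 \/ c = -1 by lia.
by case=> [->|[->|->]]; [constructor 1|constructor 2|constructor 3].
Qed.

Lemma intr_close_eq (a n : int) : n%:~R - 1 < (a%:~R : R) < n%:~R + 1 -> a = n.
Proof.
move=> /andP[lo hi].
have : n - 1 < a by rewrite -(ltr_int R) intrB.
have : a < n + 1 by rewrite -(ltr_int R) intrD.
lia.
Qed.

(** * Expansions in base [b] *)

Lemma beta_map_itv (x : R) : 0 <= beta_map b x < 1.
Proof.
rewrite /beta_map; have := ge_floor (b * x); have := floorD1_gt (b * x).
rewrite intrD; lra.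
Qed.

Lemma beta_floor_itv (x : R) : 0 <= x < 1 -> 0 <= Num.floor (b * x) <= m%:Z.
Proof.
have [bE g0 g1 m2] := quadratic_unit_bounds.
move=> x01; rewrite floor_ge0; apply/andP; split; first nra.
rewrite -ltzD1 -(ltr_int R) intrD.
apply: le_lt_trans (ge_floor _) _; rewrite -[m%:~R]/(m%:R) ; nra.
Qed.

Lemma iter_beta_itv k (y : R) : 0 <= y < 1 -> 0 <= iter k (beta_map b) y < 1.
Proof. by case: k => // k _; rewrite iterS beta_map_itv. Qed.

Lemma beta_digits_eq0P (k : nat) (y : R) : 0 <= y < 1 ->
  (forall i : nat, (k < i)%N -> beta_digit b y i = 0) <->
  iter k (beta_map b) y = 0.
Proof.
move=> y01; split=> [H|H i ki].
  apply: (@bounded_orbit_eq0 _ b).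
    by rewrite ger0_norm; have := b_ge2; lra.
  move=> n; have -> : b ^+ n * iter k (beta_map b) y = iter (n + k) (beta_map b) y.
    elim: n => [|n IH]; first by rewrite expr0 mul1r.
    rewrite addSn iterS -IH [RHS]/beta_map.
    have := H (n + k).+1; rewrite ltnS leq_addl /beta_digit /= -IH => -> //.
    by rewrite exprS; ring.
  by have := iter_beta_itv (n + k) y01 => h; rewrite ger0_norm; lra.
rewrite /beta_digit; have [j ->] : exists j, i.-1 = (j + k)%N.
  by exists (i.-1 - k)%N; lia.
rewrite iterD H (_ : iter j _ 0 = 0) ?mulr0 ?floor0 //.
by elim: j => //= j ->; rewrite /beta_map mulr0 floor0 subr0.
Qed.

(* The last clause excludes the remainder [g = b - m], whose conjugate [- b] is
   otherwise small enough. *)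
Lemma beta_expansion (k : nat) (y : R) : 0 <= y < 1 ->
  exists a c : int,
    [/\ b ^+ k * y = a%:~R + c%:~R * b + iter k (beta_map b) y,
        -1 < a%:~R - c%:~R * g < b
      & iter k (beta_map b) y = g -> a%:~R - c%:~R * g < b - 1].
Proof.
have [bE g0 g1 m2] := quadratic_unit_bounds; have bg := b_mulV.
move=> y01; elim: k => [|k [a [c [E I _]]]].
  by exists 0, 0; split=> [|| _]; rewrite ?expr0 ?mul0r ?mulr0z /=; lra.
rewrite iterS; set t := iter k _ _ in E *.
have t01 : 0 <= t < 1 by apply: iter_beta_itv.
have := beta_floor_itv t01; rewrite /beta_map; move: (Num.floor _) => n /andP[n0 nm].
have n0R : 0 <= n%:~R :> R by rewrite ler0z.
have nmR : n%:~R <= m%:R :> R by rewrite -[m%:R]/(m%:~R) ler_int.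
(* Multiply by [b] with [b ^+ 2 = m b + 1], then move the digit [n] into the integer part. The
   conjugate [z] becomes [n - z g]. *)
exists (c + n), (a + c * m%:Z).
have cE : (c + n)%:~R - (a + c * m%:Z)%:~R * g =
    n%:~R - (a%:~R - c%:~R * g) * g :> R.
  rewrite !intrD intrM -[m%:~R]/(m%:R).
  have -> : m%:R = b - g by lra.
  have -> : c%:~R + n%:~R - (a%:~R + c%:~R * (b - g)) * g =
    c%:~R * (1 - b * g) + (n%:~R - (a%:~R - c%:~R * g) * g) by ring.
  by rewrite bg; ring.
rewrite cE; set z := a%:~R - _ in I *.
have zg : - g < z * g < 1 by nra.
have nm1 : n%:~R != m%:R :> R -> n%:~R <= m%:R - 1 :> R.
  by rewrite -[m%:R]/(m%:~R) eqr_int => /(intr_le_pred R nm).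
split.
- rewrite exprS -mulrA E !intrD intrM -[m%:~R]/(m%:R).
  have -> : m%:R = b - g by lra.
  have -> : b * (a%:~R + c%:~R * b + t) = c%:~R * (b * g) + n%:~R +
      (a%:~R + c%:~R * (b - g)) * b + (b * t - n%:~R) by ring.
  by rewrite bg; ring.
- lra.
(* With digit [m] and new remainder [g], the old one would satisfy [b t = m + g = b], so [t = 1]. *)
move=> tg; suff : n%:~R <= m%:R - 1 :> R by lra.
apply: nm1; apply/eqP => nE.
nra.
Qed.

Lemma beta_integers_nnegE (x : R) : 0 <= x ->
  beta_integers_nneg b x <-> conj_in (fun z => -1 < z < b) x.
Proof.
have [bE g0 g1 m2] := quadratic_unit_bounds; have bg := b_mulV.
move=> x0; have b0 k : b ^+ k != 0 by apply/expf_neq0/lt0r_neq0; lra.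
split=> [[_ [k [y01 /(beta_digits_eq0P _ y01) t0]]]|[a [c [xE I]]]].
  have [a [c []]] := beta_expansion k y01.
  rewrite t0 mulrC divfK // addr0 => E I _.
  by exists a, c.
split=> //; have [k Hk] := expr_unbounded x b_ge2; exists k.
have y01 : 0 <= x / b ^+ k < 1.
  by rewrite ltr_pdivrMr ?mul1r ?Hk ?divr_ge0 //; lra.
split=> //; apply/beta_digits_eq0P => //.
have [a1 [c1 []]] := beta_expansion k y01.
have := iter_beta_itv k y01; set t := iter _ _ _ => t01.
rewrite mulrC divfK // => E I1 It.
have tE : t = (a - a1)%:~R + (c - c1)%:~R * b by rewrite !intrB; lra.
have zE : (a - a1)%:~R - (c - c1)%:~R * g =
   (a%:~R - c%:~R * g) - (a1%:~R - c1%:~R * g) :> R by rewrite !intrB; ring.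
have := coef_small tE; rewrite zE => cs.
have {}cs : `|c - c1| <= 1 by apply: cs; rewrite ltr_norml; lra.
move: zE tE; case: (int_norm_le1_cases cs) => ->; set d := a - a1 => zE tE.
- suff d0 : d = 0 by rewrite tE d0; lra.
  by apply: intr_close_eq; lra.
(* Here [t = b - m = g]. The last clause of the expansion makes the conjugate difference exceed
   [- b], while it equals [- m - g = - b]. *)
- have dE : d = - m%:Z by apply: intr_close_eq; rewrite intrN -[m%:~R]/(m%:R); lra.
  move: tE zE; rewrite dE intrN -[m%:~R]/(m%:R) => tE zE.
  by have := It ltac:(lra); lra.
(* The conjugate difference would be [m + 1 + g = b + 1], but both windows force it below
   [b + 1]. *)
have dE : d = m%:Z + 1.
  by apply: intr_close_eq; rewrite intrD -[m%:~R]/(m%:R); lra.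
move: tE zE; rewrite dE intrD -[m%:~R]/(m%:R) => tE zE; lra.
Qed.

(** * Expansions in base [- b] *)

Local Notation l := (negbeta_left b).

(** The first clause replaces the fraction [l] by an equation linear in [b * l]; the last holds
    since [l + 1 = 1 / (b + 1)]. *)
Lemma negbeta_left_bounds : [/\ b * l = - b - l, -1 < l, l < - 2^-1 & l + 1 < g].
Proof.
have [bE g0 g1 m2] := quadratic_unit_bounds; have bg := b_mulV.
have lE : b * l = - b - l.
  rewrite /negbeta_left; field; apply: lt0r_neq0; lra.
by split=> //; nra.
Qed.

Lemma negbeta_map_itv (x : R) : l <= negbeta_map b x < l + 1.
Proof.
rewrite /negbeta_map; have := ge_floor (- b * x - l).
have := floorD1_gt (- b * x - l); rewrite intrD; lra.
Qed.

Lemma negbeta_floor_itv (x : R) : l <= x < l + 1 ->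
  0 <= Num.floor (- b * x - l) <= m%:Z.
Proof.
have [bE g0 g1 m2] := quadratic_unit_bounds.
have [lE _ _ _] := negbeta_left_bounds.
move=> x01; rewrite floor_ge0; apply/andP; split; first nra.
rewrite -ltzD1 -(ltr_int R) intrD.
apply: le_lt_trans (ge_floor _) _; rewrite -[m%:~R]/(m%:R); nra.
Qed.

Lemma iter_negbeta_itv k (y : R) : l <= y < l + 1 ->
  l <= iter k (negbeta_map b) y < l + 1.
Proof. by case: k => // k _; rewrite iterS negbeta_map_itv. Qed.

Lemma negbeta_digits_eq0P (k : nat) (y : R) : l <= y < l + 1 ->
  (forall i : nat, (k < i)%N -> negbeta_digit b y i = 0) <->
  iter k (negbeta_map b) y = 0.
Proof.
have [_ l1 l2 _] := negbeta_left_bounds; have b2 := b_ge2.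
have fl : Num.floor (- l) = 0 by apply: floor_def; rewrite add0r; lra.
move=> y01; split=> [H|H i ki].
  apply: (@bounded_orbit_eq0 _ (- b)); first by rewrite normrN ger0_norm; lra.
  move=> n.
  have -> : (- b) ^+ n * iter k (negbeta_map b) y = iter (n + k) (negbeta_map b) y.
    elim: n => [|n IH]; first by rewrite expr0 mul1r.
    rewrite addSn iterS -IH [RHS]/negbeta_map.
    have := H (n + k).+1; rewrite ltnS leq_addl /negbeta_digit /= -IH => -> //.
    by rewrite exprS; ring.
  by have := iter_negbeta_itv (n + k) y01 => h; rewrite ler_norml; lra.
rewrite /negbeta_digit; have [j ->] : exists j, i.-1 = (j + k)%N.
  by exists (i.-1 - k)%N; lia.
rewrite iterD H (_ : iter j _ 0 = 0) ?mulr0 ?sub0r ?fl //.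
by elim: j => //= j ->; rewrite /negbeta_map mulr0 !sub0r fl oppr0.
Qed.

(* The last clause reflects that a digit [m] cannot be followed by the
   remainder 0; this is where [2 <= m] matters. *)
Lemma negbeta_expansion (k : nat) (y : R) : l <= y < l + 1 ->
  exists a c : int,
    [/\ (- b) ^+ k * y = a%:~R + c%:~R * b + iter k (negbeta_map b) y,
        0 <= a%:~R - c%:~R * g < b + 1
      & iter k (negbeta_map b) y = 0 -> a%:~R - c%:~R * g < b].
Proof.
have [bE g0 g1 m2] := quadratic_unit_bounds; have bg := b_mulV.
have [lE l1 l2 _] := negbeta_left_bounds.
move=> y01; elim: k => [|k [a [c [E I _]]]].
  by exists 0, 0; split=> [|| _]; rewrite ?expr0 ?mul0r ?mulr0z /=; lra.
rewrite iterS; set t := iter k _ _ in E *.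
have t01 : l <= t < l + 1 by apply: iter_negbeta_itv.
have := negbeta_floor_itv t01; rewrite /negbeta_map; move: (Num.floor _) => n /andP[n0 nm].
have n0R : 0 <= n%:~R :> R by rewrite ler0z.
have nmR : n%:~R <= m%:R :> R by rewrite -[m%:R]/(m%:~R) ler_int.
(* As for base [b], but multiplying by [- b]: the conjugate [z] becomes [n + z g]. *)
exists (n - c), (- (a + c * m%:Z)).
have cE : (n - c)%:~R - (- (a + c * m%:Z))%:~R * g =
    n%:~R + (a%:~R - c%:~R * g) * g :> R.
  rewrite intrB intrN intrD intrM -[m%:~R]/(m%:R).
  have -> : m%:R = b - g by lra.
  have -> : n%:~R - c%:~R - - (a%:~R + c%:~R * (b - g)) * g =
    c%:~R * (b * g - 1) + (n%:~R + (a%:~R - c%:~R * g) * g) by ring.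
  by rewrite bg; ring.
rewrite cE; set z := a%:~R - _ in I *.
have zg : 0 <= z * g < 1 + g by nra.
split.
- rewrite exprS -mulrA E intrB intrN intrD intrM -[m%:~R]/(m%:R).
  have -> : m%:R = b - g by lra.
  have -> : - b * (a%:~R + c%:~R * b + t) = n%:~R - c%:~R * (b * g) +
      - (a%:~R + c%:~R * (b - g)) * b + (- b * t - n%:~R) by ring.
  by rewrite bg; ring.
- lra.
move=> t0; suff : n%:~R <= m%:R - 1 :> R by lra.
(* Digit [m] with remainder 0 means [t = - m / b], which is below [l] because
   [m (b + 1) > m b + 1 = b ^+ 2]. *)
apply: (intr_le_pred R nm); apply/eqP => nE.
by move: t0; rewrite nE -[m%:~R]/(m%:R); nra.
Qed.

Lemma negbeta_integersE (x : R) :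
  negbeta_integers b x <-> conj_in (fun z => 0 <= z < b) x.
Proof.
have [bE g0 g1 m2] := quadratic_unit_bounds; have bg := b_mulV.
have [lE l1 l2 lg] := negbeta_left_bounds.
have b0 k : (- b) ^+ k != 0.
  by rewrite expf_neq0 // oppr_eq0; apply: lt0r_neq0; lra.
split=> [[k [/andP[ly yl]]]|[a [c [xE I]]]].
  have y01 : l <= x / (- b) ^+ k < l + 1 by rewrite ltW.
  move=> /(negbeta_digits_eq0P _ y01) t0.
  have [a [c []]] := negbeta_expansion k y01.
  rewrite t0 mulrC divfK // addr0 => E I Ib.
  by exists a, c; split=> //; have := Ib erefl; lra.
(* This gives [|x| / b ^+ k < 1 / (b + 1) = l + 1], which suffices on both sides as
   [l < - (l + 1)]. *)
have [k Hk] := expr_unbounded (`|x| * (b + 1)) b_ge2; exists k.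
have y01 : l < x / (- b) ^+ k < l + 1.
  have : `|x / (- b) ^+ k| < l + 1.
    rewrite normrM normfV normrX normrN (@ger0_norm _ b); last lra.
    rewrite ltr_pdivrMr; last by apply: exprn_gt0; lra.
    have lb : (b + 1) * (l + 1) = 1 by lra.
    have -> : `|x| = `|x| * ((b + 1) * (l + 1)) by rewrite lb mulr1.
    by rewrite mulrA [ltRHS]mulrC ltr_pM2r; lra.
  by rewrite ltr_norml; lra.
have y01' : l <= x / (- b) ^+ k < l + 1 by lra.
split=> //; apply/negbeta_digits_eq0P => //.
have [a1 [c1 []]] := negbeta_expansion k y01'.
have := iter_negbeta_itv k y01'; set t := iter _ _ _ => t01.
rewrite mulrC divfK // => E I1 _.
have tE : t = (a - a1)%:~R + (c - c1)%:~R * b by rewrite !intrB; lra.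
have zE : (a - a1)%:~R - (c - c1)%:~R * g =
   (a%:~R - c%:~R * g) - (a1%:~R - c1%:~R * g) :> R by rewrite !intrB; ring.
have := coef_small tE; rewrite zE => cs.
have {}cs : `|c - c1| <= 1 by apply: cs; rewrite ltr_norml; lra.
move: zE tE; case: (int_norm_le1_cases cs) => ->; set d := a - a1 => zE tE.
- suff d0 : d = 0 by rewrite tE d0; lra.
  by apply: intr_close_eq; lra.
(* In the two remaining cases the conjugate difference would be [- b - 1] or [b], the excluded
   endpoints of its range. *)
- have dE : d = - m%:Z - 1.
    by apply: intr_close_eq; rewrite intrB intrN -[m%:~R]/(m%:R); lra.
  move: tE zE; rewrite dE intrB intrN -[m%:~R]/(m%:R) => tE zE; lra.
have dE : d = m%:Z by apply: intr_close_eq; rewrite -[m%:~R]/(m%:R); lra.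
move: tE zE; rewrite dE -[m%:~R]/(m%:R) => tE zE; lra.
Qed.

(** * Multiplication by [b] and comparison of the windows *)

(** The conjugate of [b] is [- g]; the converse uses that [b] is a unit, with inverse [b - m] in
    [Z[b]]. *)
Lemma conj_in_mul_b (P : R -> Prop) (x : R) :
  conj_in (fun z => P (- (z * g))) x <-> conj_in P (b * x).
Proof.
have [bE g0 g1 m2] := quadratic_unit_bounds; have bg := b_mulV.
have b0 : b != 0 by apply: lt0r_neq0; lra.
split=> -[a [c [xE Pz]]].
  exists c, (a + c * m%:Z); rewrite intrD intrM -[m%:~R]/(m%:R).
  have -> : m%:R = b - g by lra.
  split.
    apply/eqP; rewrite xE -subr_eq0.
    have -> : b * (a%:~R + c%:~R * b) - (c%:~R + (a%:~R + c%:~R * (b - g)) * b) =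
      c%:~R * (b * g - 1) by ring.
    by rewrite bg subrr mulr0.
  have -> : c%:~R - (a%:~R + c%:~R * (b - g)) * g =
    - ((a%:~R - c%:~R * g) * g) + c%:~R * (1 - b * g) by ring.
  by rewrite bg subrr mulr0 addr0.
exists (c - a * m%:Z), a; rewrite intrB intrM -[m%:~R]/(m%:R).
have -> : m%:R = b - g by lra.
split.
  apply: (mulfI b0); rewrite xE.
  have -> : b * (c%:~R - a%:~R * (b - g) + a%:~R * b) =
    c%:~R * b + a%:~R * (b * g) by ring.
  by rewrite bg; ring.
have -> // : - ((c%:~R - a%:~R * (b - g) - a%:~R * g) * g) =
  a%:~R - c%:~R * g + a%:~R * (b * g - 1) by ring.
by rewrite bg subrr mulr0 addr0.
Qed.

End QuadraticUnit.

Theorem theorem4p1 (R : realType) (m : nat) (hm : (2 <= m)%N) (b : R)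
    (hb1 : 1 < b) (hb : root ('X^2 - m%:R *: 'X - 1) b) :
  beta_integers b `&` [set x | 0 <= x] =
  (negbeta_integers b `|` [set b * x | x in negbeta_integers b])
    `&` [set x | 0 <= x].
Proof.
have [bE g0 g1 m2] := quadratic_unit_bounds hm hb1 hb.
have bg := b_mulV hm hb1 hb.
have nnegE x := @beta_integers_nnegE R m b hm hb1 hb x.
have negE x := @negbeta_integersE R m b hm hb1 hb x.
have mulE P x := @conj_in_mul_b R m b hm hb1 hb P x.
apply/seteqP; split=> x /= [Hx x0]; split=> //.
  have /(nnegE _ x0) [a [c [xE I]]] : beta_integers_nneg b x.
    (* A nonnegative [x = - y] with [y >= 0] is 0, hence equal to [y]. *)
    case: Hx => // -[y Hy yx]; have [y0 _] := Hy.
    by have <- : y = x by lra.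
  (* A conjugate in [[0, b)] makes [x] itself a [(-b)]-integer; one in [(-1, 0)] gives [x / b] a
     conjugate in [(0, b)]. *)
  have [z0|z0] := leP 0 (a%:~R - c%:~R * b^-1).
    by left; apply/negE; exists a, c; split=> //; lra.
  right; exists (x / b); last by rewrite mulrC divfK //; apply: lt0r_neq0; lra.
  apply/negE.
  have : conj_in b (fun z => -1 < z < 0) (b * (x / b)).
    rewrite mulrC divfK; last by apply: lt0r_neq0; lra.
    by exists a, c; split=> //; lra.
  move=> /(mulE (fun z => -1 < z < 0) (x / b)).2 [a' [c' [E I']]]; exists a', c'; split=> //.
  nra.
(* Both windows [[0, b)] and [(-1, 0]] lie in [(-1, b)]. *)
left; apply/nnegE => //; case: Hx => [/negE[a [c [xE I]]]|[y /negE[a [c [yE I]]] <-]].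
  by exists a, c; split=> //; lra.
apply/(mulE (fun z => -1 < z < b) y).1; exists a, c; split=> //.
nra.
Qed.
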